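(* Let $\Gamma$ be a variable typing environment and $\Delta$ a safe operator typing environment such that $\Gamma,\Delta\vdash C:\alpha$ and $\Gamma,\Delta\vdash D:\alpha$ for commands $C,D$ and a tier $\alpha$. Assume $\mu\vDash C\approx_{\Gamma,\Delta}\sigma\vDash D$. Then: (i) if $\mu\vDash C\to_s\mu'\vDash C'$, there exist $\sigma'$ and $D'$ with $\sigma\vDash D\to_s^*\sigma'\vDash D'$ and $\mu'\vDash C'\approx_{\Gamma,\Delta}\sigma'\vDash D'$; (ii) if $\mu\vDash C\to_s\mu'$, there exists $\sigma'$ with $\sigma\vDash D\to_s^*\sigma'$ and $\mu'\approx_{\Gamma,\Delta}\sigma'$.
   Context: Words: $\mathcal{W}$ is the set of finite words over a finite alphabet $\Sigma$, containing distinguished words $\texttt{tt},\texttt{ff}$. Operators $op$ have fixed arity $n\ge0$ and are interpreted as total functions $[\![op]\!]:\mathcal{W}^n\to\mathcal{W}$. Expressions: $E ::= X \mid op(E_1,\dots,E_n)$ ($X$ a variable). Commands: $C ::= X:=E \mid C;C' \mid \texttt{skip}\mid \texttt{if } E\texttt{ then } C\texttt{ else } C'\mid\texttt{while}(E)\{C\}$. A store $\mu$ maps variables to words; $\mu[X\leftarrow d]$ is the updated store. Expression evaluation $\mu\vDash E\Downarrow d$: a variable $X$ evaluates to $\mu(X)$; $op(E_1,\dots,E_n)$ evaluates to $[\![op]\!](d_1,\dots,d_n)$ where $E_i$ evaluates to $d_i$. A configuration is either a pair $\mu\vDash C$ or a store $\mu$. Small-step relation $\to_s$: $\mu\vDash\texttt{skip}\to_s\mu$;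 $\mu\vDash X:=E\to_s\mu[X\leftarrow d]$ where $\mu\vDash E\Downarrow d$; if $\mu\vDash C_1\to_s\mu_1$ then $\mu\vDash C_1;C_2\to_s\mu_1\vDash C_2$; if $\mu\vDash C_1\to_s\mu_1\vDash C_1'$ then $\mu\vDash C_1;C_2\to_s\mu_1\vDash C_1';C_2$; if $\mu\vDash E\Downarrow w\in\{\texttt{tt},\texttt{ff}\}$ then $\mu\vDash\texttt{if } E\texttt{ then } C_{\texttt{tt}}\texttt{ else } C_{\texttt{ff}}\to_s\mu\vDash C_w$; if $\mu\vDash E\Downarrow\texttt{ff}$ then $\mu\vDash\texttt{while}(E)\{C\}\to_s\mu$; if $\mu\vDash E\Downarrow\texttt{tt}$ then $\mu\vDash\texttt{while}(E)\{C\}\to_s\mu\vDash C;\texttt{while}(E)\{C\}$. $\to_s^*$ is the reflexive-transitive closure. Tiers $\mathbf{0}\preceq\mathbf{1}$ with $\vee,\wedge$. $\Gamma$ maps variables to tiers; $\Delta$ maps each operator of arity $n$ to a set of types $\alpha_1\to\cdots\to\alpha_n\to\alpha$. Typing: $\Gamma,\Delta\vdash X:\Gamma(X)$; $op(E_1,\dots,E_n):\alpha$ if $E_i:\alpha_i$ and $\alpha_1\to\cdots\to\alpha_n\to\alpha\in\Delta(op)$; $X:=E:\beta$ if $X:\beta$, $E:\alpha$, $\beta\preceq\alpha$; $C;C':\alpha\vee\beta$ if $C:\alpha$, $C':\beta$; $\texttt{skip}:\alpha$ for any $\alpha$; $\texttt{if }E\texttt{ then }C\texttt{ else }C':\alpha$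 if $E,C,C'$ all have type $\alpha$; $\texttt{while}(E)\{C\}:\mathbf{1}$ if $E:\mathbf{1}$ and $C:\alpha$ for some $\alpha$. $v\trianglelefteq w$ iff $w=uvu'$. Neutral operator: $[\![op]\!]$ takes only values $\texttt{tt},\texttt{ff}$, or for all arguments the result is a sub-word of some argument. Positive operator: $|[\![op]\!](d_1,\dots,d_n)|\le\max_i|d_i|+c$ for a constant $c$. Standing assumption: every operator is neutral or positive. $\Delta$ is safe if every type $\alpha_1\to\cdots\to\alpha_n\to\alpha\in\Delta(op)$ satisfies $\alpha\preceq\bigwedge_i\alpha_i$, and $\alpha=\mathbf{0}$ if $op$ is positive but not neutral. Equivalence: $\mu\approx_{\Gamma,\Delta}\sigma$ iff $\mu(X)=\sigma(X)$ for all $X\in\mathrm{dom}(\Gamma)$ with $\Gamma(X)=\mathbf{1}$. On commands, $\approx_{\Gamma,\Delta}$ is the least relation such that: $C\approx C$; $C\approx C'$ whenever $\Gamma,\Delta\vdash C:\mathbf{0}$ and $\Gamma,\Delta\vdash C':\mathbf{0}$; if $C\approx C'$ and $D\approx D'$ then $C;D\approx C';D'$. On configurations: $\mu\vDash C\approx_{\Gamma,\Delta}\sigma\vDash C'$ iff $C\approx_{\Gamma,\Delta}C'$ and $\mu\approx_{\Gamma,\Delta}\sigma$.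
   Formalization: It is additionally assumed that no run from σ⊨D gets stuck, i.e. every guard D evaluates yields tt or ff; otherwise the claim fails, e.g. C = skip, D = if Y then skip else skip with Y of tier 0 and σ(Y) neither tt nor ff. *)

(* Defs.v *)
From mathcomp Require Import all_boot all_order.
From Stdlib Require Import Relation_Operators.

Set Implicit Arguments.
Unset Strict Implicit.
Unset Printing Implicit Defensive.

Record language := Language {
  symbol : finType;
  tt_word : seq symbol;
  ff_word : seq symbol;
  tt_neq_ff : tt_word != ff_word;
  variable : eqType;
  operator : Type;
  arity : operator -> nat;
  interp : forall o : operator, (arity o).-tuple (seq symbol) -> seq symbol
}.

Definition word (L : language) := seq (symbol L).

Section Syntax.
Variable L : language.

Inductive expr : Type :=
| EVar (X : variable L)
| EOp (o : operator L) (es : 'I_(arity o) -> expr).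

Inductive cmd : Type :=
| CAssign (X : variable L) (e : expr)
| CSeq (C C' : cmd)
| CSkip
| CIf (e : expr) (Ctt Cff : cmd)
| CWhile (e : expr) (C : cmd).

End Syntax.

Arguments CSkip {L}.

Section Semantics.
Variable L : language.

Definition store := variable L -> word L.

Definition update (mu : store) (X : variable L) (d : word L) : store :=
  fun Y => if Y == X then d else mu Y.

Inductive eval (mu : store) : expr L -> word L -> Prop :=
| eval_var X : eval mu (EVar X) (mu X)
| eval_op (o : operator L) (es : 'I_(arity o) -> expr L)
    (ds : (arity o).-tuple (word L)) :
    (forall i, eval mu (es i) (tnth ds i)) ->
    eval mu (EOp es) (interp ds).

Inductive config : Type :=
| Run (mu : store) (C : cmd L)
| Final (mu : store).

Inductive step : config -> config -> Prop :=
| step_skip mu : step (Run mu CSkip) (Final mu)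
| step_assign mu X e d :
    eval mu e d -> step (Run mu (CAssign X e)) (Final (update mu X d))
| step_seq_final mu mu1 C1 C2 :
    step (Run mu C1) (Final mu1) ->
    step (Run mu (CSeq C1 C2)) (Run mu1 C2)
| step_seq_run mu mu1 C1 C1' C2 :
    step (Run mu C1) (Run mu1 C1') ->
    step (Run mu (CSeq C1 C2)) (Run mu1 (CSeq C1' C2))
| step_if_tt mu e Ctt Cff :
    eval mu e (tt_word L) -> step (Run mu (CIf e Ctt Cff)) (Run mu Ctt)
| step_if_ff mu e Ctt Cff :
    eval mu e (ff_word L) -> step (Run mu (CIf e Ctt Cff)) (Run mu Cff)
| step_while_ff mu e C :
    eval mu e (ff_word L) -> step (Run mu (CWhile e C)) (Final mu)
| step_while_tt mu e C :
    eval mu e (tt_word L) ->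
    step (Run mu (CWhile e C)) (Run mu (CSeq C (CWhile e C))).

Definition steps : config -> config -> Prop := clos_refl_trans config step.

(* Stores are total and operators receive exactly as many arguments as their
   arity, so a running configuration has no successor only when the guard it
   has to evaluate yields a word other than tt and ff. Typing does not exclude
   this, since tiers do not separate truth values from other words. *)
Definition never_stuck (c : config) : Prop :=
  forall mu C, steps c (Run mu C) -> exists c', step (Run mu C) c'.

End Semantics.

(* Tiers are booleans with their library order, so that the meet of an empty
   family of tiers is tier 1. *)
Definition tier := bool.
Definition tier0 : tier := false.
Definition tier1 : tier := true.

Definition tier_le (a b : tier) : bool := (a <= b)%O.
Definition tier_join (a b : tier) : tier := (a `|` b)%O.
Definition tier_meets n (t : n.-tuple tier) : tier :=
  (\meet_(i < n) tnth t i)%O.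

Section Typing.
Variable L : language.

(* The domain of the environment is the set of variables not sent to None. *)
Definition var_env := variable L -> option tier.

(* A type t_1 -> ... -> t_n -> t is the pair of the tuple of the t_i and t. *)
Definition op_env :=
  forall o : operator L, {set (arity o).-tuple tier * tier}.

Variables (Gamma : var_env) (Delta : op_env).

Inductive typed_expr : expr L -> tier -> Prop :=
| typed_var X a : Gamma X = Some a -> typed_expr (EVar X) a
| typed_op (o : operator L) (es : 'I_(arity o) -> expr L)
    (t : (arity o).-tuple tier) a :
    (forall i, typed_expr (es i) (tnth t i)) ->
    (t, a) \in Delta o ->
    typed_expr (EOp es) a.

Inductive typed_cmd : cmd L -> tier -> Prop :=
| typed_assign X e a b :
    typed_expr (EVar X) b -> typed_expr e a -> tier_le b a ->
    typed_cmd (CAssign X e) b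
| typed_seq C C' a b :
    typed_cmd C a -> typed_cmd C' b -> typed_cmd (CSeq C C') (tier_join a b)
| typed_skip a : typed_cmd CSkip a
| typed_if e C C' a :
    typed_expr e a -> typed_cmd C a -> typed_cmd C' a ->
    typed_cmd (CIf e C C') a
| typed_while e C a :
    typed_expr e tier1 -> typed_cmd C a -> typed_cmd (CWhile e C) tier1.

Definition neutral (o : operator L) : Prop :=
  (forall ds : (arity o).-tuple (word L),
     interp ds = tt_word L \/ interp ds = ff_word L) \/
  (forall ds : (arity o).-tuple (word L),
     exists i, infix (interp ds) (tnth ds i)).

Definition positive (o : operator L) : Prop :=
  exists c : nat, forall ds : (arity o).-tuple (word L),
    size (interp ds) <= \max_(i < arity o) size (tnth ds i) + c.

Definition safe : Prop :=
  forall (o : operator L) (t : (arity o).-tuple tier) (a : tier),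
    (t, a) \in Delta o ->
    tier_le a (tier_meets t) /\ (positive o /\ ~ neutral o -> a = tier0).

Definition store_equiv (mu sigma : store L) : Prop :=
  forall X, Gamma X = Some tier1 -> mu X = sigma X.

Inductive cmd_equiv : cmd L -> cmd L -> Prop :=
| cmd_equiv_refl C : cmd_equiv C C
| cmd_equiv_tier0 C C' :
    typed_cmd C tier0 -> typed_cmd C' tier0 -> cmd_equiv C C'
| cmd_equiv_seq C C' D D' :
    cmd_equiv C C' -> cmd_equiv D D' -> cmd_equiv (CSeq C D) (CSeq C' D').

Inductive config_equiv : config L -> config L -> Prop :=
| config_equiv_run mu sigma C C' :
    cmd_equiv C C' -> store_equiv mu sigma ->
    config_equiv (Run mu C) (Run sigma C').

End Typing.

(* Main.v *)
Require Import Defs.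
From mathcomp Require Import all_boot all_order.
From Stdlib Require Import Relation_Operators.

(** A tier-1 expression only reads tier-1 variables, so related stores evaluate
    it alike; hence identical commands follow the same control flow as long as
    their guards have tier 1. A tier-0 command contains no loop and assigns no
    tier-1 variable: each of its steps is matched by no step at all, and, unless
    it gets stuck on a guard, it terminates in a related store. *)

Set Implicit Arguments.
Unset Strict Implicit.
Unset Printing Implicit Defensive.

Section Evaluation.
Variable L : language.

(** Stores and operators are total, so evaluation is a function; agreement of two stores on an
    expression then becomes an equation. *)
Fixpoint value (mu : store L) (e : expr L) : word L :=
  match e with
  | EVar X => mu X
  | EOp o es => interp [tuple value mu (es i) | i < arity o]
  end.

Lemma eval_value (mu : store L) (e : expr L) : eval mu e (value mu e).
Proof.
elim: e => [X|o es IH] /=; first exact: eval_var.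
by apply: eval_op => i; rewrite tnth_mktuple.
Qed.

Lemma value_eval (mu : store L) (e : expr L) (d : word L) :
  eval mu e d -> d = value mu e.
Proof.
elim=> [X|o es ds _ IH] //=; congr interp.
by apply: eq_from_tnth => i; rewrite tnth_mktuple.
Qed.

End Evaluation.

Lemma never_stuck_steps (L : language) (c c' : config L) :
  steps c c' -> never_stuck c -> never_stuck c'.
Proof. by move=> Hs Hc mu C Hs'; apply: (Hc mu C); apply: rt_trans Hs'. Qed.

Section Sequence.
Variables (L : language) (D : cmd L).

(** The context that puts [D] after a configuration; it merges the two reduction rules for sequences
    into one. *)
Definition seq_config (c : config L) : config L :=
  match c with
  | Run mu C => Run mu (CSeq C D)
  | Final mu => Run mu D
  end.

Lemma step_seq_config (c c' : config L) :
  step c c' -> step (seq_config c) (seq_config c').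
Proof.
case: c => [mu C|mu] Hs; last by inversion Hs.
by case: c' Hs => *; [exact: step_seq_run | exact: step_seq_final].
Qed.

Lemma steps_seq_config (c c' : config L) :
  steps c c' -> steps (seq_config c) (seq_config c').
Proof.
elim=> [x y Hs|x|x y z _ IHxy _ IHyz]; last exact: rt_trans IHxy IHyz.
  exact/rt_step/step_seq_config.
exact: rt_refl.
Qed.

(** A run of [C] lifts to a run of the sequence, whose next step can only come from a step of its
    first component. *)
Lemma never_stuck_seql (mu : store L) (C : cmd L) :
  never_stuck (Run mu (CSeq C D)) -> never_stuck (Run mu C).
Proof.
move=> Hns nu C' /steps_seq_config /Hns [c' Hs].
by inversion Hs; subst; eexists; eassumption.
Qed.

End Sequence.

Section NonInterference.
Variables (L : language) (Gamma : var_env L) (Delta : op_env L).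

Lemma store_equiv_trans (mu nu sigma : store L) :
  store_equiv Gamma mu nu -> store_equiv Gamma nu sigma ->
  store_equiv Gamma mu sigma.
Proof. by move=> H1 H2 X HX; rewrite H1 // H2. Qed.

Lemma store_equiv_sym (mu sigma : store L) :
  store_equiv Gamma mu sigma -> store_equiv Gamma sigma mu.
Proof. by move=> H X HX; rewrite H. Qed.

Lemma store_equiv_update (mu : store L) (X : variable L) (d : word L) :
  Gamma X = Some tier0 -> store_equiv Gamma mu (update mu X d).
Proof. by move=> HX Y HY; rewrite /update; case: eqP => // E; rewrite E HX in HY. Qed.

Lemma typed_var_inv (X : variable L) (a : tier) :
  typed_expr Gamma Delta (EVar X) a -> Gamma X = Some a.
Proof. by move=> H; inversion H. Qed.

(** Safety bounds the result tier by the meet of the argument tiers, so tier 1 propagates from the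
    root down to every variable. *)
Lemma value_tier1 (mu sigma : store L) (e : expr L) :
  safe Delta -> store_equiv Gamma mu sigma ->
  typed_expr Gamma Delta e tier1 -> value mu e = value sigma e.
Proof.
move=> Hsafe Heq Ht; move: {1 2}tier1 Ht (erefl tier1) => a.
elim=> [X {}a HX Ha|o es t {}a _ IH Hin Ha] /=; first by apply: Heq; rewrite HX Ha.
congr interp; apply: eq_from_tnth => i; rewrite !tnth_mktuple; apply: IH.
have [+ _] := Hsafe o t a Hin; rewrite Ha /tier_meets /tier_le.
move/Order.TMeetTheory.meetsP => /(_ i isT); by case: (tnth t i).
Qed.

Lemma eval_tier1 (mu sigma : store L) (e : expr L) (d : word L) :
  safe Delta -> store_equiv Gamma mu sigma ->
  typed_expr Gamma Delta e tier1 -> eval mu e d -> eval sigma e d.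
Proof.
move=> Hsafe Heq Ht /value_eval ->.
by rewrite (value_tier1 Hsafe Heq Ht); exact: eval_value.
Qed.

Lemma typed_seq0_inv (C C' : cmd L) :
  typed_cmd Gamma Delta (CSeq C C') tier0 ->
  typed_cmd Gamma Delta C tier0 /\ typed_cmd Gamma Delta C' tier0.
Proof.
by move=> H; inversion H as [|? ? [] [] H1 H2| | |].
Qed.

Lemma step_tier0 (mu : store L) (C : cmd L) (c : config L) :
  typed_cmd Gamma Delta C tier0 -> step (Run mu C) c ->
  match c with
  | Run mu' C' => typed_cmd Gamma Delta C' tier0 /\ store_equiv Gamma mu mu'
  | Final mu' => store_equiv Gamma mu mu'
  end.
Proof.
elim: C mu c => [X e|C IHC C' _||e Ctt _ Cff _|e C _] mu c Ht Hs.
- inversion Ht; subst; inversion Hs; subst.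
  exact/store_equiv_update/typed_var_inv.
- have [HC HC'] := typed_seq0_inv Ht.
  inversion Hs as [| |? ? ? ? Hs1|? ? ? ? ? Hs1| | | |]; subst.
    by have := IHC _ _ HC Hs1.
  have [HC1 Heq] := IHC _ _ HC Hs1.
  by split=> //; rewrite -[tier0]/(tier_join tier0 tier0); apply: typed_seq.
- by inversion Hs.
- by inversion Ht; subst; inversion Hs; subst; split.
- by inversion Ht.
Qed.

(** Loops only have tier 1, so structural induction on [C] suffices. *)
Lemma termination_tier0 (mu : store L) (C : cmd L) :
  typed_cmd Gamma Delta C tier0 -> never_stuck (Run mu C) ->
  exists2 mu', steps (Run mu C) (Final mu') & store_equiv Gamma mu mu'.
Proof.
elim: C mu => [X e|C IHC C' IHC'||e Ctt IHtt Cff IHff|e C _] mu Ht Hns.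
- exists (update mu X (value mu e)); first exact/rt_step/step_assign/eval_value.
  inversion Ht; subst; exact/store_equiv_update/typed_var_inv.
- have [HC HC'] := typed_seq0_inv Ht.
  have [mu1 Hs1 Heq1] := IHC _ HC (never_stuck_seql Hns).
  have {}Hs1 := steps_seq_config C' Hs1.
  have [mu2 Hs2 Heq2] := IHC' _ HC' (never_stuck_steps Hs1 Hns).
  exists mu2; first exact: rt_trans Hs1 Hs2.
  exact: store_equiv_trans Heq1 Heq2.
- by exists mu => //; exact/rt_step/step_skip.
(* Not being stuck here means that the guard evaluates to tt or ff, which selects the branch to
   run. *)
- have [c Hs] := Hns _ _ (rt_refl _ _ _).
  have Hns' := never_stuck_steps (rt_step _ _ _ _ Hs) Hns.
  inversion Ht; inversion Hs; subst;
    [have [|//|mu' Hs' Heq] := IHtt mu | have [|//|mu' Hs' Heq] := IHff mu] => //;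
    by exists mu' => //; apply: rt_trans Hs'; apply: rt_step.
- by inversion Ht.
Qed.

(** Both conclusions of the theorem in one predicate, so that a single induction proves them
    together: [c] is a successor of the first configuration, [d] the second configuration before it
    answers. *)
Definition matches (d : config L) (c : config L) : Prop :=
  match c with
  | Run mu C => exists sigma D,
      steps d (Run sigma D) /\
      config_equiv Gamma Delta (Run mu C) (Run sigma D)
  | Final mu => exists sigma, steps d (Final sigma) /\ store_equiv Gamma mu sigma
  end.

(** Only the first components move. If [C1] finishes, running [D1] to its end leaves [C2] facing
    [D2]. *)
Lemma matches_seq (mu sigma : store L) (C1 C2 D1 D2 : cmd L) (c : config L) :
  cmd_equiv Gamma Delta C2 D2 ->
  (forall c1, step (Run mu C1) c1 -> matches (Run sigma D1) c1) ->
  step (Run mu (CSeq C1 C2)) c -> matches (Run sigma (CSeq D1 D2)) c.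
Proof.
move=> Heq IH Hs.
inversion Hs as [| |? ? ? ? Hs1|? ? ? ? ? Hs1| | | |]; subst.
  have [sigma' [Hss Hst]] := IH _ Hs1.
  exists sigma', D2; split; last exact: config_equiv_run.
  exact: (steps_seq_config D2 Hss).
have [sigma' [D' [Hss Hst]]] := IH _ Hs1; inversion Hst; subst.
exists sigma', (CSeq D' D2); split; first exact: (steps_seq_config D2 Hss).
by apply: config_equiv_run => //; apply: cmd_equiv_seq.
Qed.

Lemma matches_tier0 (mu sigma : store L) (C D : cmd L) (c : config L) :
  typed_cmd Gamma Delta C tier0 -> typed_cmd Gamma Delta D tier0 ->
  store_equiv Gamma mu sigma -> never_stuck (Run sigma D) ->
  step (Run mu C) c -> matches (Run sigma D) c.
Proof.
move=> HC HD Heq Hns /(step_tier0 HC); case: c => [mu' C' [HC' Heq']|mu' Heq'].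
  (* While the first command is still running, [D] waits; once it finishes, [D] runs to
     completion. *)
  exists sigma, D; split; first exact: rt_refl.
  apply: config_equiv_run; first exact: cmd_equiv_tier0.
  exact: store_equiv_trans (store_equiv_sym Heq') Heq.
have [sigma' Hs Heq''] := termination_tier0 HD Hns.
exists sigma'; split=> //.
exact: store_equiv_trans (store_equiv_sym Heq') (store_equiv_trans Heq Heq'').
Qed.

Lemma matches_refl (mu sigma : store L) (C : cmd L) (a : tier) (c : config L) :
  safe Delta -> typed_cmd Gamma Delta C a ->
  store_equiv Gamma mu sigma -> never_stuck (Run sigma C) ->
  step (Run mu C) c -> matches (Run sigma C) c.
Proof.
move=> Hsafe Ht Heq; elim: Ht c => {C a}.
- move=> X e a b HX He Hle c Hns Hs; case: b HX Hle => [HX Hle|HX Hle]; last first.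
    by apply: matches_tier0 Hs => //; apply: typed_assign Hle.
  inversion Hs as [|? ? ? d Hd| | | | | |]; subst.
  exists (update sigma X d); split; last first.
    by move=> Y HY; rewrite /update; case: eqP => // _; apply: Heq.
  apply/rt_step/step_assign/(eval_tier1 Hsafe Heq _ Hd).
  (* The target has tier 1 here, so [Hle] forces the assigned expression to have tier 1 as well. *)
  by case: a He Hle.
- move=> C C' a b _ IHC _ _ c Hns; apply: matches_seq; first exact: cmd_equiv_refl.
  by move=> c1; apply: IHC; apply: never_stuck_seql Hns.
- move=> _ c _ Hs; inversion Hs; subst.
  by exists sigma; split=> //; exact/rt_step/step_skip.
(* A tier-0 guard may select different branches in the two stores, but then the whole conditional
   has tier 0. *)
- move=> e C C' [] He HC _ HC' _ c Hns Hs; last first.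
    by apply: matches_tier0 Hs => //; apply: typed_if.
  inversion Hs as [| | | |? ? ? ? Hd|? ? ? ? Hd| |]; subst.
    exists sigma, C; split; last by apply: config_equiv_run => //; exact: cmd_equiv_refl.
    exact/rt_step/step_if_tt/(eval_tier1 Hsafe Heq He Hd).
  exists sigma, C'; split; last by apply: config_equiv_run => //; exact: cmd_equiv_refl.
  exact/rt_step/step_if_ff/(eval_tier1 Hsafe Heq He Hd).
- move=> e C a He _ _ c Hns Hs.
  inversion Hs as [| | | | | |? ? ? Hd|? ? ? Hd]; subst.
    exists sigma; split=> //.
    exact/rt_step/step_while_ff/(eval_tier1 Hsafe Heq He Hd).
  (* The tier-1 guard makes both sides unfold the loop, leaving identical commands. *)
  exists sigma, (CSeq C (CWhile e C)).
  split; last by apply: config_equiv_run => //; exact: cmd_equiv_refl.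
  exact/rt_step/step_while_tt/(eval_tier1 Hsafe Heq He Hd).
Qed.

(* The two types may differ: equivalent sequences need not have componentwise
   equal types, even when the types of the sequences agree. *)
Lemma matches_equiv (mu sigma : store L) (C D : cmd L) (a b : tier)
    (c : config L) :
  safe Delta -> cmd_equiv Gamma Delta C D ->
  typed_cmd Gamma Delta C a -> typed_cmd Gamma Delta D b ->
  store_equiv Gamma mu sigma -> never_stuck (Run sigma D) ->
  step (Run mu C) c -> matches (Run sigma D) c.
Proof.
move=> Hsafe Hequiv HC HD Heq; elim: Hequiv a b c HC HD => {C D}.
- by move=> C a b c HC _; apply: matches_refl HC Heq.
- by move=> C D HC HD _ _ c _ _; apply: matches_tier0.
- move=> C1 D1 C2 D2 _ IH1 Heq2 _ a b c HC HD Hns.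
  inversion HC; inversion HD; subst; apply: matches_seq => // c1.
  by apply: IH1; [eassumption | eassumption | exact: never_stuck_seql Hns].
Qed.

End NonInterference.

Theorem theorem1 (L : language)
    (Hop : forall o : operator L, neutral o \/ positive o)
    (Gamma : var_env L) (Delta : op_env L) (Hsafe : safe Delta)
    (C D : cmd L) (alpha : tier)
    (HC : typed_cmd Gamma Delta C alpha) (HD : typed_cmd Gamma Delta D alpha)
    (mu sigma : store L) (HrunD : never_stuck (Run sigma D))
    (Hequiv : config_equiv Gamma Delta (Run mu C) (Run sigma D)) :
  (forall (mu' : store L) (C' : cmd L),
     step (Run mu C) (Run mu' C') ->
     exists (sigma' : store L) (D' : cmd L),
       steps (Run sigma D) (Run sigma' D') /\
       config_equiv Gamma Delta (Run mu' C') (Run sigma' D')) /\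
  (forall mu' : store L,
     step (Run mu C) (Final mu') ->
     exists sigma' : store L,
       steps (Run sigma D) (Final sigma') /\ store_equiv Gamma mu' sigma').
Proof.
inversion Hequiv as [? ? ? ? Hcmd Hst]; subst.
have Hmatch c : step (Run mu C) c -> matches Gamma Delta (Run sigma D) c.
  exact: matches_equiv Hsafe Hcmd HC HD Hst HrunD.
by split=> [mu' C' /Hmatch|mu' /Hmatch].
Qed.
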